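(* Let $\mathcal{C}_n \subseteq \mathbb{C}^{n \times n}$ be the affine variety of $n\times n$ companion matrices. For all integers $n, r \geq 1$, $$\dim \mu_r(\mathcal{C}_n) = \min\{rn,\ n^2\}.$$
   Context: For an affine variety $X \subseteq \mathbb{C}^{n\times n}$ and an integer $r \geq 1$, let $\mu_r^0(X) = \{M_1\cdots M_r : M_1,\dots,M_r \in X\}$ and let $\mu_r(X)$ be the Zariski closure of $\mu_r^0(X)$ in $\mathbb{C}^{n\times n}$. An $n\times n$ companion matrix is a matrix of the form $$\begin{bmatrix} 0 & 0 & \cdots & 0 & c_1\\ 1 & 0 & \cdots & 0 & c_2\\ \vdots & \vdots & \ddots & \vdots & \vdots\\ 0 & 0 & \cdots & 1 & c_n\end{bmatrix},\qquad c_1,\dots,c_n \in \mathbb{C},$$ that is, the last column is arbitrary, the entries $(i+1,i)$ for $1 \leq i \leq n-1$ equal $1$, and all other entries in the first $n-1$ columns are $0$. Dimension is the (Krull) dimension of an affine variety over $\mathbb{C}$. *)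

(* Defs.v *)
From HB Require Import structures.
From mathcomp Require Import all_boot all_order all_algebra.
From mathcomp Require Import boolp classical_sets reals.
From mathcomp Require Import complex mpoly.

Set Implicit Arguments.
Unset Strict Implicit.
Unset Printing Implicit Defensive.

Import Order.TTheory GRing.Theory Num.Theory.

Local Open Scope classical_set_scope.
Local Open Scope ring_scope.

(* Polynomials on the affine space 'M[K]_n have one variable per entry, in
   the row-major order of mxvec. *)
Definition mxeval (K : fieldType) (n : nat) (p : {mpoly K[(n * n)%N]})
  (A : 'M[K]_n) : K := p.@[fun k => mxvec A 0 k].

Definition zeros (K : fieldType) (n : nat) (S : set {mpoly K[(n * n)%N]}) :
  set 'M[K]_n := [set A | forall p, S p -> mxeval p A = 0].

Definition zariski_closed (K : fieldType) (n : nat) (Z : set 'M[K]_n) : Prop :=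
  exists S : set {mpoly K[(n * n)%N]}, Z = zeros S.

Definition zariski_closure (K : fieldType) (n : nat) (X : set 'M[K]_n) :
  set 'M[K]_n := smallest (@zariski_closed K n) X.

Definition irreducible_closed (K : fieldType) (n : nat) (Z : set 'M[K]_n) :
  Prop :=
  [/\ zariski_closed Z, Z !=set0 &
      forall Z1 Z2 : set 'M[K]_n, zariski_closed Z1 -> zariski_closed Z2 ->
        Z = Z1 `|` Z2 -> Z = Z1 \/ Z = Z2].

(* Z 0, ..., Z d is a strictly increasing chain, so d counts inclusions; the
   values of Z beyond d are irrelevant. *)
Definition irreducible_chain (K : fieldType) (n : nat) (X : set 'M[K]_n)
  (d : nat) (Z : nat -> set 'M[K]_n) : Prop :=
  (forall i, (i <= d)%N -> irreducible_closed (Z i) /\ Z i `<=` X) /\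
  (forall i, (i < d)%N -> Z i `<` Z i.+1).

(* Intended for Zariski closed X: the closed subsets of X are then the closed
   subsets of 'M[K]_n contained in X. *)
Definition has_krull_dim (K : fieldType) (n : nat) (X : set 'M[K]_n)
  (d : nat) : Prop :=
  (exists Z, irreducible_chain X d Z) /\
  (forall e Z, irreducible_chain X e Z -> (e <= d)%N).

Definition mu0 (K : fieldType) (n r : nat) (X : set 'M[K]_n) : set 'M[K]_n :=
  [set A | exists M : 'I_r -> 'M[K]_n,
     (forall i, X (M i)) /\ A = \big[mulmx/1%:M]_(i < r) M i].

Definition mu (K : fieldType) (n r : nat) (X : set 'M[K]_n) : set 'M[K]_n :=
  zariski_closure (mu0 r X).

(* The library's companionmx is the transposed shape, and is indexed by a
   polynomial rather than by its last column. *)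
Definition companion (K : fieldType) (n : nat) (c : 'cV[K]_n) : 'M[K]_n :=
  \matrix_(i, j) if j.+1 == n then c i 0 else (i == j.+1 :> nat)%:R.

Definition companion_variety (K : fieldType) (n : nat) : set 'M[K]_n :=
  range (@companion K n).
Arguments companion_variety : clear implicits.

(* Main.v *)
Require Import Defs.
From HB Require Import structures.
From mathcomp Require Import all_boot all_order all_algebra.
From mathcomp Require Import boolp classical_sets reals.
From mathcomp Require Import perm complex mpoly zify.

Import GRing.Theory Num.Theory.

(** Multiplying A on the right by a companion matrix drops the first column of
A, moves the others one place to the left, and appends A *m c, where c is the
last column of the companion matrix; if A is invertible, A *m c is an arbitrary
vector.  Starting from the identity, every product of r companion matrices thus
has e_(r+1), ..., e_n as its first n - r columns (numbered from 1), and the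
remaining min(r, n) columns are expected to be arbitrary.  The closure mu_r is
indeed the whole affine space shifted_identity of matrices with these prescribed
first columns (mu_companion).  For density, a matrix T of step r + 1 is undone by
prepending a column: this gives a matrix A of step r, and T is A times a
companion matrix as soon as A is invertible.  Right multiplication by a fixed
matrix is continuous, so these T lie in mu_(r+1) by induction on r.  The others
follow by restricting to the line that joins T to a power of the cyclic
permutation matrix, for which A is invertible: on this line det A is a nonzero
polynomial in one variable.

It remains to see that an affine space with d free coordinates has Krull
dimension d (coord_subspace_krull_dim).  Freeing the coordinates one at a time
gives a chain of length d.  For the upper bound, take a chain
Z_0 < ... < Z_e of irreducible closed subsets and f_i vanishing on Z_i but not
on Z_(i+1).  Then f_0, ..., f_(e-1) are algebraically independent as functions
on Z_e (chain_alg_independent): in a relation, divide by the highest power of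
the last f_i, which is allowed because Z_e is irreducible, then restrict to
Z_(e-1).  Expressed in the d free coordinates, they are e polynomials in d
variables, so e <= d by counting monomials (mpoly_alg_dependent). *)

Local Open Scope ring_scope.

(** * Algebraic dependence of polynomials *)

(** The predecessor of msize is the total degree, with the zero polynomial in
degree 0; this convention makes the bounds below hold without side conditions. *)
Lemma msizeM_pred (K : fieldType) (d : nat) (p q : {mpoly K[d]}) :
  ((msize (p * q)).-1 <= (msize p).-1 + (msize q).-1)%N.
Proof.
have [->|p0] := eqVneq p 0; first by rewrite mul0r msize0.
have [->|q0] := eqVneq q 0; first by rewrite mulr0 msize0.
rewrite msizeM //.
move: p0 q0; rewrite -!msize_poly_eq0.
by case: (msize p) => // a; case: (msize q) => // b; rewrite addSn addnS.
Qed.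

Lemma msizeX_pred (K : fieldType) (d : nat) (p : {mpoly K[d]}) (k : nat) :
  ((msize (p ^+ k)).-1 <= k * (msize p).-1)%N.
Proof.
elim: k => [|k IH]; first by rewrite expr0 msize1.
by rewrite exprS mulSn (leq_trans (msizeM_pred _ _ _ _)) // leq_add2l.
Qed.

Lemma msize_prod_pred (K : fieldType) (d e D s : nat)
    (g : 'I_e -> {mpoly K[d]}) (a : 'I_e -> nat) :
  (forall i, (msize (g i)).-1 <= D)%N -> (forall i, a i <= s)%N ->
  ((msize (\prod_i g i ^+ a i)).-1 <= e * (s * D))%N.
Proof.
move=> gD as_.
have -> : (e * (s * D) = \sum_(i < e) s * D)%N.
  by rewrite sum_nat_const card_ord.
elim/big_ind2: _ => [|x1 x2 y1 y2 h1 h2|i _]; first by rewrite msize1.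
  by rewrite (leq_trans (msizeM_pred _ _ _ _)) // leq_add.
by rewrite (leq_trans (msizeX_pred _ _ _ _)) // leq_mul.
Qed.

Lemma card_bmultinom (d B : nat) : (#|{: 'X_{1..d < B.+1}}| <= B.+1 ^ d)%N.
Proof.
pose f (m : 'X_{1..d < B.+1}) : {ffun 'I_d -> 'I_B.+1} :=
  [ffun i => inord (m i)].
have f_inj : injective f.
  move=> m1 m2 /ffunP eq_f; apply/val_inj/mnmP => i.
  have bnd (m : 'X_{1..d < B.+1}) : (m i < B.+1)%N.
    apply: leq_ltn_trans (bmdeg m).
    by rewrite mdegE (bigD1 i) //= leq_addr.
  by have /(congr1 val) := eq_f i; rewrite !ffunE /= !inordK.
by have := leq_card f f_inj; rewrite card_ffun !card_ord.
Qed.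

(** The (s+1)^e monomials of multidegree at most s in the g_i have degree O(s) in
d variables, hence lie in a space of dimension O(s^d); for d < e and large s they
must be linearly dependent. *)
Lemma mpoly_alg_dependent (K : fieldType) (d e : nat)
    (g : 'I_e -> {mpoly K[d]}) : (d < e)%N ->
  exists2 P : {mpoly K[e]}, P != 0 & P \mPo [tuple g i | i < e] = 0.
Proof.
move=> lt_de.
(* The degree of each monomial in the g_i is at most B, and B + 1 <= (s + 1) * c;
   the value s = c ^ d gives ((s + 1) * c) ^ d < (s + 1) ^ d.+1. *)
pose D := \max_i (msize (g i)).-1.
pose c := (e * D).+1; pose s := (c ^ d)%N; pose B := (e * (s * D))%N.
pose W := {ffun 'I_e -> 'I_s.+1}.
pose mon (a : W) : 'X_{1..e} := [multinom (a i : nat) | i < e].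
have mon_inj : injective mon.
  move=> a b /mnmP eq_ab; apply/ffunP => i; apply: val_inj.
  by have := eq_ab i; rewrite !mnmE.
pose G (a : W) := 'X_[mon a] \mPo [tuple g i | i < e].
have sizeG a : (msize (G a) <= B.+1)%N.
  suff : ((msize (G a)).-1 <= B)%N by case: (msize _).
  rewrite /G comp_mpolyX.
  under eq_bigr do rewrite tnth_mktuple mnmE.
  apply: msize_prod_pred => i; last by rewrite -ltnS.
  exact: (leq_bigmax (F := fun i => (msize (g i)).-1)).
have card_lt : (#|{: 'X_{1..d < B.+1}}| < #|{: W}|)%N.
  rewrite card_ffun !card_ord (leq_ltn_trans (card_bmultinom _ _)) //.
  have B_le : (B.+1 <= s.+1 * c)%N.
    rewrite /B mulnCA /c mulSn mulnS; lia.
  apply: (@leq_ltn_trans ((s.+1 * c) ^ d)).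
    by case: (d) => // k; rewrite leq_exp2r.
  rewrite expnMn; apply: (@leq_trans (s.+1 ^ d * s.+1)).
    by rewrite ltn_pmul2l ?expn_gt0 // ltnSn.
  by rewrite mulnC -expnS leq_pexp2l.
(* Row i lists the coefficients of the i-th monomial in the g_i, so a vector in
   the left kernel is a linear relation. *)
pose M : 'M[K]_(#|{: W}|, #|{: 'X_{1..d < B.+1}}|) :=
  \matrix_(i, j) (G (enum_val i))@_(enum_val j : 'X_{1..d < B.+1}).
have : kermx M != 0.
  rewrite kermx_eq0 /row_free neq_ltn.
  by rewrite (leq_ltn_trans (rank_leq_col M)).
case/rowV0Pn => v /sub_kermxP vM v0.
pose P : {mpoly K[e]} := \sum_i v 0 i *: 'X_[mon (enum_val i)].
have coefP i : P@_(mon (enum_val i)) = v 0 i.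
  rewrite raddf_sum (bigD1 i) //= mcoeffZ mcoeffX eqxx mulr1 big1 ?addr0 //.
  move=> j ji; rewrite mcoeffZ mcoeffX (inj_eq mon_inj) (inj_eq enum_val_inj).
  by rewrite (negbTE ji) mulr0.
exists P.
  apply: contraNneq v0 => P0; apply/eqP/rowP => i.
  by rewrite -coefP P0 mcoeff0 mxE.
rewrite raddf_sum /=; apply/mpolyP => m; rewrite mcoeff0 raddf_sum /=.
have [ltmB|leBm] := ltnP (mdeg m) B.+1.
  pose bm := BMultinom ltmB.
  have /matrixP/(_ 0 (enum_rank bm)) := vM; rewrite !mxE => vM0.
  rewrite -[RHS]vM0; apply: eq_bigr => i _.
  by rewrite comp_mpolyZ mcoeffZ mxE enum_rankK.
rewrite big1 // => i _.
rewrite comp_mpolyZ mcoeffZ memN_msupp_eq0 ?mulr0 //.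
by apply: msize_mdeg_ge; apply: leq_trans (sizeG _) leBm.
Qed.

(** Isolating the last variable lets statements on e.+1 variables be proved by
induction on a univariate polynomial over {mpoly K[e]}. *)
Lemma mpoly_uniE (K : fieldType) (e : nat) (P : {mpoly K[e.+1]}) :
  exists Q : {poly {mpoly K[e]}}, P = (map_poly (@mwiden e K) Q).['X_ord_max].
Proof.
elim/mpolyind: P => [|c m P _ _ [Q ->]].
  by exists 0; rewrite rmorph0 horner0.
pose m' : 'X_{1..e} := [multinom m (widen_ord (leqnSn e) i) | i < e].
exists ((c *: 'X_[m'])%:P * 'X^(m ord_max) + Q).
rewrite rmorphD rmorphM /= map_polyC map_polyXn /= hornerD hornerCM hornerXn.
congr (_ + _); rewrite mwidenZ -scalerAl; congr (_ *: _).
rewrite [LHS]mpolyXE_id big_ord_recr /=; congr (_ * _).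
rewrite mpolyXE_id rmorph_prod /=; apply: eq_bigr => i _.
by rewrite rmorphXn /= mnmE mwidenX mnmwiden1; congr ('X_ _ ^+ m _).
Qed.

Lemma meval_mwiden (K : fieldType) (e : nat) (p : {mpoly K[e]}) v :
  (mwiden p).@[v] = p.@[fun i => v (widen_ord (leqnSn e) i)].
Proof.
elim/mpolyind: p => [|c m p _ _ IH]; first by rewrite mwiden0 !meval0.
rewrite mwidenD !mevalD IH; congr (_ + _).
rewrite mwidenZ !mevalZ mwidenX !mevalX big_ord_recr /=.
rewrite mnmwiden_ordmax expr0 mulr1; congr (_ * _).
apply: eq_bigr => i _; rewrite -(mnmwiden_widen m i).
by congr (v _ ^+ _ _); exact: val_inj.
Qed.

(** * Zariski closure and restriction to lines *)

Local Open Scope classical_set_scope.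

Lemma zeros_closed (K : fieldType) (n : nat) (S : set {mpoly K[(n * n)%N]}) :
  zariski_closed (zeros S).
Proof. by exists S. Qed.

Lemma closedI_zero (K : fieldType) (n : nat) (Z : set 'M[K]_n)
    (p : {mpoly K[(n * n)%N]}) :
  zariski_closed Z -> zariski_closed (Z `&` [set A | mxeval p A = 0]).
Proof.
move=> [S ->]; exists (S `|` [set p]); apply/seteqP; split=> A /=.
  by move=> [SA pA] q [/SA //|->].
by move=> h; split=> [q Sq|]; apply: h; [left|right].
Qed.

Lemma closed_separated (K : fieldType) (n : nat) (Z : set 'M[K]_n) A :
  zariski_closed Z -> ~ Z A ->
  exists2 p, (forall B, Z B -> mxeval p B = 0) & mxeval p A != 0.
Proof.
move=> [S ->] /existsNP[p /not_implyP[Sp /eqP pA]].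
by exists p => // B; apply.
Qed.

Lemma in_zariski_closure (K : fieldType) (n : nat) (X : set 'M[K]_n) A :
  zariski_closure X A <->
  (forall p, (forall B, X B -> mxeval p B = 0) -> mxeval p A = 0).
Proof.
split=> [clA p pX|h Z [[S ->] XZ] p Sp].
  apply: (clA (zeros [set p])); last exact: erefl.
  by split; [exact: zeros_closed|move=> B XB _ ->; exact: pX].
by apply: h => B /XZ; apply.
Qed.

(** Right multiplication is Zariski continuous: a polynomial in the entries of
A *m B is a polynomial in the entries of A. *)
Lemma zariski_closure_mulmxr (K : fieldType) (n : nat) (X Y : set 'M[K]_n) B :
  (forall A, X A -> Y (A *m B)) ->
  forall A, zariski_closure X A -> zariski_closure Y (A *m B).
Proof.
move=> XY A /in_zariski_closure clA; apply/in_zariski_closure => p pY.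
pose l k := \sum_j (lin_mulmxr B) j k *: 'X_j : {mpoly K[(n * n)%N]}.
have evalE C : mxeval (p \mPo [tuple l k | k < (n * n)%N]) C =
               mxeval p (C *m B).
  rewrite /mxeval comp_mpoly_meval; apply: meval_eq => k.
  rewrite tnth_mktuple raddf_sum /= -[C *m B]/(mulmxr B C) -mul_vec_lin mxE.
  by apply: eq_bigr => j _; rewrite mevalZ mevalXU mulrC.
by rewrite -evalE; apply: clA => C /XY /pY; rewrite evalE.
Qed.

Lemma mxeval_line (K : fieldType) (n : nat) (p : {mpoly K[(n * n)%N]})
    (A B : 'M[K]_n) :
  exists q : {poly K}, forall t, q.[t] = mxeval p (A + t *: B).
Proof.
exists (mmap polyC (fun k => (mxvec A 0 k)%:P + mxvec B 0 k *: 'X) p) => t.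
rewrite /mxeval mevalE /mmap horner_sum; apply: eq_bigr => m _.
rewrite hornerM hornerC /mmap1 horner_prod; congr (_ * _).
apply: eq_bigr => k _.
by rewrite horner_exp !hornerE linearD linearZ !mxE mulrC.
Qed.

Lemma det_line (K : fieldType) (n : nat) (A B : 'M[K]_n) :
  exists q : {poly K}, forall t, q.[t] = \det (A + t *: B).
Proof.
exists (\det (map_mx polyC A + 'X *: map_mx polyC B)) => t.
rewrite -[LHS]/(horner_eval t _) -det_map_mx; congr (\det _).
by apply/matrixP => i j; rewrite !mxE /= /horner_eval !hornerE.
Qed.

Definition line_closed (K : fieldType) (n : nat) (L : set 'M[K]_n) :=
  forall A B t, L A -> L B -> L (A + t *: (B - A)).
Arguments line_closed {K n}.

Lemma lineE0 (K : fieldType) (n : nat) (A B : 'M[K]_n) :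
  A + 0 *: (B - A) = A.
Proof. by rewrite scale0r addr0. Qed.

Lemma lineE1 (K : fieldType) (n : nat) (A B : 'M[K]_n) :
  A + 1 *: (B - A) = B.
Proof. by rewrite scale1r addrC subrK. Qed.

Lemma poly_nonroot (K : numFieldType) (q : {poly K}) :
  q != 0 -> exists t, q.[t] != 0.
Proof.
move=> q0; apply: contrapT => /forallNP all0.
pose rs := [seq i%:R : K | i <- iota 0 (size q)].
have rs_uniq : uniq rs.
  by rewrite map_inj_uniq ?iota_uniq // => i j /eqP; rewrite eqr_nat => /eqP.
have /(max_poly_roots q0) : all (root q) rs.
  by apply/allP => t _; apply/negPn/negP => h; apply: (all0 t).
by move/(_ rs_uniq); rewrite size_map size_iota ltnn.
Qed.

(** Two conditions that are open on a line and each satisfied somewhere on it are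
satisfied together: this is how irreducibility of lines gets used. *)
Lemma poly_nonroot2 (K : numFieldType) (q1 q2 : {poly K}) t1 t2 :
  q1.[t1] != 0 -> q2.[t2] != 0 -> exists t, (q1.[t] != 0) && (q2.[t] != 0).
Proof.
move=> q1t q2t.
have nz (q : {poly K}) t : q.[t] != 0 -> q != 0.
  by apply: contraNneq => ->; rewrite horner0.
have [t] := poly_nonroot _ _ (mulf_neq0 (nz _ _ q1t) (nz _ _ q2t)).
by rewrite hornerM mulf_eq0 negb_or; exists t.
Qed.

(** If L were the union of two proper closed subsets, polynomials witnessing
properness at two points A and B would both be nonzero on the line AB, although
their product vanishes on it. *)
Lemma line_closed_irreducible (K : numFieldType) (n : nat)
    (L : set 'M[K]_n) :
  zariski_closed L -> L !=set0 -> line_closed L -> irreducible_closed L.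
Proof.
move=> cL L0 lineL; split=> // Z1 Z2 c1 c2 LE.
have [sub1|/existsNP[A /not_implyP[LA Z1A]]] := pselect (L `<=` Z1).
  by left; apply/seteqP; split=> // B Z1B; rewrite LE; left.
have [sub2|/existsNP[B /not_implyP[LB Z2B]]] := pselect (L `<=` Z2).
  by right; apply/seteqP; split=> // B Z2B; rewrite LE; right.
exfalso.
have [p1 p1Z p1A] := closed_separated _ _ _ _ c1 Z1A.
have [p2 p2Z p2B] := closed_separated _ _ _ _ c2 Z2B.
have [q1 q1E] := mxeval_line _ _ p1 A (B - A).
have [q2 q2E] := mxeval_line _ _ p2 A (B - A).
have [||t] := poly_nonroot2 _ q1 q2 0 1.
- by rewrite q1E lineE0.
- by rewrite q2E lineE1.
rewrite q1E q2E.
have : L (A + t *: (B - A)) by exact: lineL.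
rewrite LE => -[/p1Z|/p2Z] ->; by rewrite eqxx ?andbF.
Qed.

(** Z is the union of its intersections with the zero sets of p and q, so one of
them is all of Z: the ideal of an irreducible set is prime. *)
Lemma irreducible_mul_eq0 (K : fieldType) (n : nat) (Z : set 'M[K]_n)
    (p q : {mpoly K[(n * n)%N]}) :
  irreducible_closed Z -> (forall A, Z A -> mxeval p A * mxeval q A = 0) ->
  (forall A, Z A -> mxeval p A = 0) \/ (forall A, Z A -> mxeval q A = 0).
Proof.
move=> [cZ _ irrZ] pq0.
have [|h|h] := irrZ _ _ (closedI_zero _ _ _ p cZ) (closedI_zero _ _ _ q cZ).
- apply/seteqP; split=> A; last by case=> -[].
  move=> ZA; have /eqP := pq0 _ ZA.
  by rewrite mulf_eq0 => /orP[]/eqP h; [left|right].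
- by left=> A; rewrite {1}h => -[].
- by right=> A; rewrite {1}h => -[].
Qed.

(** * Dimension of coordinate subspaces *)

(** Write a relation as Q * 'X + c with 'X standing for f_e.  On Z_e, where f_e
vanishes, only c remains, and it is zero by induction on e.  What is left is
Q * 'X, and f_e may be cancelled since the ideal of Z_(e+1) is prime and does not
contain it; then Q, which is shorter, is a relation as well. *)
Lemma chain_alg_independent (K : fieldType) (n : nat)
    (Z : nat -> set 'M[K]_n) (f : nat -> {mpoly K[(n * n)%N]}) (e : nat) :
  (forall i, (i <= e)%N -> irreducible_closed (Z i)) ->
  (forall i, (i < e)%N -> Z i `<=` Z i.+1) ->
  (forall i, (i < e)%N -> forall A, Z i A -> mxeval (f i) A = 0) ->
  (forall i, (i < e)%N -> ~ forall A, Z i.+1 A -> mxeval (f i) A = 0) ->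
  forall P : {mpoly K[e]},
    (forall A, Z e A -> P.@[fun i : 'I_e => mxeval (f i) A] = 0) -> P = 0.
Proof.
elim: e => [|e IH] irrZ subZ fZ fNZ P PZ.
  have [_ [A ZA] _] := irrZ 0%N isT.
  have PC : P = (P@_0)%:MP.
    apply/mpolyP => m; rewrite mcoeffC.
    have -> : m = 0%MM by apply/mnmP => -[].
    by rewrite eqxx mulr1.
  by have := PZ A ZA; rewrite PC mevalC => ->; rewrite mpolyC0.
have {}IH : forall P : {mpoly K[e]},
    (forall A, Z e A -> P.@[fun i : 'I_e => mxeval (f i) A] = 0) -> P = 0.
  apply: IH => i ie.
  - exact: irrZ (leqW ie).
  - exact: subZ (leqW ie).
  - exact: fZ (leqW ie).
  - exact: fNZ (leqW ie).
have [Q PQ] := mpoly_uniE _ _ P; rewrite PQ in PZ *.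
suff -> : Q = 0 by rewrite rmorph0 horner0.
elim/poly_ind: Q {P PQ} PZ => // Q c IHQ PZ.
have evalE A : ((map_poly (@mwiden e K) (Q * 'X + c%:P)).['X_ord_max])
      .@[fun i : 'I_e.+1 => mxeval (f i) A] =
   ((map_poly (@mwiden e K) Q).['X_ord_max])
      .@[fun i : 'I_e.+1 => mxeval (f i) A] * mxeval (f e) A
     + c.@[fun i : 'I_e => mxeval (f i) A].
  rewrite rmorphD rmorphM /= map_polyX map_polyC hornerMXaddC.
  by rewrite mevalD mevalM mevalXU meval_mwiden.
have c0 : c = 0.
  apply: IH => A ZA; have := PZ A (subZ _ (ltnSn e) _ ZA).
  by rewrite evalE (fZ e) // mulr0 add0r.
rewrite c0 addr0 IHQ ?mul0r //.
pose g := (map_poly (@mwiden e K) Q).['X_ord_max] \mPo [tuple f i | i < e.+1].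
have gE A : mxeval g A = ((map_poly (@mwiden e K) Q).['X_ord_max])
    .@[fun i : 'I_e.+1 => mxeval (f i) A].
  rewrite /mxeval /g comp_mpoly_meval; apply: meval_eq => i.
  by rewrite tnth_mktuple.
have [|h A /h|/fNZ] := irreducible_mul_eq0 _ _ _ g (f e) (irrZ _ (leqnn _)).
- by move=> A /PZ; rewrite evalE c0 meval0 addr0 gE.
- by rewrite gE.
- by move/(_ (ltnSn e)).
Qed.

Definition coord_subspace (K : fieldType) (n : nat) (S : {set 'I_(n * n)})
  (A0 : 'M[K]_n) : set 'M[K]_n :=
  [set A | forall k, k \notin S -> mxvec A 0 k = mxvec A0 0 k].
Arguments coord_subspace {K n}.

Lemma coord_subspace_line_closed (K : fieldType) (n : nat)
    (S : {set 'I_(n * n)}) (A0 : 'M[K]_n) :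
  line_closed (coord_subspace S A0).
Proof.
move=> A B t LA LB k kS; rewrite !(linearD, linearZ, linearN) /= !mxE.
by rewrite LA // LB // subrr mulr0 addr0.
Qed.

Lemma coord_subspace_closed (K : fieldType) (n : nat)
    (S : {set 'I_(n * n)}) (A0 : 'M[K]_n) :
  zariski_closed (coord_subspace S A0).
Proof.
exists [set p | exists2 k, k \notin S & p = 'X_k - (mxvec A0 0 k)%:MP].
have evalE k A : mxeval ('X_k - (mxvec A0 0 k)%:MP) A =
    mxvec A 0 k - mxvec A0 0 k by rewrite /mxeval mevalB mevalXU mevalC.
apply/seteqP; split=> A.
  by move=> LA _ [k kS ->]; rewrite evalE LA // subrr.
move=> h k kS; apply/eqP; rewrite -subr_eq0 -evalE; apply/eqP/h.
by exists k.
Qed.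

Lemma coord_subspace_irreducible (K : numFieldType) (n : nat)
    (S : {set 'I_(n * n)}) (A0 : 'M[K]_n) :
  irreducible_closed (coord_subspace S A0).
Proof.
apply: line_closed_irreducible; first exact: coord_subspace_closed.
  by exists A0.
exact: coord_subspace_line_closed.
Qed.

Lemma coord_subspace_chain (K : numFieldType) (n : nat)
    (S : {set 'I_(n * n)}) (A0 : 'M[K]_n) :
  exists Z, irreducible_chain (coord_subspace S A0) #|S| Z.
Proof.
pose T i := [set k in take i (enum S)].
exists (fun i => coord_subspace (T i) A0); split=> i iS.
  split; first exact: coord_subspace_irreducible.
  move=> A LA k kS; apply: LA; apply: contra kS.
  by rewrite inE => /mem_take; rewrite mem_enum.
have lt_i : (i < size (enum S))%N by rewrite -cardE.
have [k0 _] : exists k, k \in S by apply/card_gt0P; apply: leq_trans iS.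
pose k := nth k0 (enum S) i.
have TS : T i.+1 = k |: T i.
  by apply/setP => j; rewrite !inE (take_nth k0) // mem_rcons inE.
have kT : k \notin T i.
  have := take_uniq i.+1 (enum_uniq S).
  by rewrite (take_nth k0) // rcons_uniq inE => /andP[].
split=> [A LA j|].
  by rewrite TS !inE negb_or => /andP[_ jT]; apply: LA; rewrite inE.
(* Moving A0 along the new free coordinate leaves the smaller subspace. *)
move=> /(_ (A0 + vec_mx (delta_mx 0 k))) h.
have /h/(_ k kT) : coord_subspace (T i.+1) A0 (A0 + vec_mx (delta_mx 0 k)).
  move=> j; rewrite TS in_setU1 negb_or => /andP[jk _].
  by rewrite linearD /= vec_mxK !mxE (negbTE jk) andbF addr0.
rewrite linearD /= vec_mxK !mxE !eqxx => /eqP.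
by rewrite -subr_eq0 addrAC subrr add0r oner_eq0.
Qed.

(** Regular functions on the subspace are polynomials in its #|S| free
coordinates. *)
Lemma coord_subspace_param (K : fieldType) (n : nat)
    (S : {set 'I_(n * n)}) (A0 : 'M[K]_n) (p : {mpoly K[(n * n)%N]}) :
  exists q : {mpoly K[#|S|]}, forall A, coord_subspace S A0 A ->
    q.@[fun i => mxvec A 0 (enum_val i)] = mxeval p A.
Proof.
have /choice[l lE] : forall k, exists q : {mpoly K[#|S|]},
    forall A, coord_subspace S A0 A ->
      q.@[fun i => mxvec A 0 (enum_val i)] = mxvec A 0 k.
  move=> k; have [kS|kS] := boolP (k \in S).
    by exists 'X_(enum_rank_in kS k) => A _; rewrite mevalXU enum_rankK_in.
  by exists (mxvec A0 0 k)%:MP => A LA; rewrite mevalC LA.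
exists (p \mPo [tuple l k | k < (n * n)%N]) => A LA.
rewrite comp_mpoly_meval; apply: meval_eq => k.
by rewrite tnth_mktuple lE.
Qed.

(** A chain of length e > #|S| would provide e algebraically independent regular
functions, whereas these are polynomials in only #|S| variables. *)
Lemma coord_subspace_krull_dim (K : numFieldType) (n : nat)
    (S : {set 'I_(n * n)}) (A0 : 'M[K]_n) :
  has_krull_dim (coord_subspace S A0) #|S|.
Proof.
split=> [|e Z [irrZ ltZ]]; first exact: coord_subspace_chain.
rewrite leqNgt; apply/negP => lt_Se.
have subZ i : (i < e)%N -> Z i `<=` Z i.+1 by case/ltZ.
have /choice[f fP] : forall i, exists p : {mpoly K[(n * n)%N]}, (i < e)%N ->
    (forall A, Z i A -> mxeval p A = 0) /\
    ~ forall A, Z i.+1 A -> mxeval p A = 0.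
  move=> i; have [ie|_] := ltnP i e; last by exists 0.
  have [_ /existsNP[A /not_implyP[ZA ZNA]]] := ltZ i ie.
  have [[cZ _ _] _] := irrZ i (ltnW ie).
  have [p pZ pA] := closed_separated _ _ _ _ cZ ZNA.
  by exists p => _; split=> // /(_ A ZA) p0; rewrite p0 eqxx in pA.
have /choice[g gE] := coord_subspace_param _ _ S A0.
have [P P0 Pg] := mpoly_alg_dependent _ _ _ (fun i : 'I_e => g (f i)) lt_Se.
move/eqP: P0; apply.
apply: (chain_alg_independent _ _ Z f) =>
  [i /irrZ[] //|//|i /fP[] //|i /fP[] //|].
move=> A ZA; have [_ /(_ A ZA) LA] := irrZ e (leqnn e).
have := congr1 (meval (fun i => mxvec A 0 (enum_val i))) Pg.
rewrite meval0 comp_mpoly_meval => <-; apply: meval_eq => i.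
by rewrite tnth_mktuple gE.
Qed.

(** * Products of companion matrices *)

(** The affine space that turns out to be mu_r: column j, counted from 0, is the
basis vector e_(j+r) as long as this exists, and free otherwise. *)
Definition shifted_identity (K : fieldType) (n r : nat) : set 'M[K]_n :=
  [set T : 'M[K]_n | forall i j : 'I_n, (j + r < n)%N ->
     T i j = (i == (j + r)%N :> nat)%:R].

Lemma mulmx_companion (K : fieldType) (m : nat) (A : 'M[K]_m.+1) c i j :
  (A *m companion c) i j =
    if j.+1 == m.+1 then (A *m c) i 0 else A i (inord j.+1).
Proof.
rewrite mxE; case: ifPn => jm.
  by rewrite mxE; apply: eq_bigr => k _; rewrite mxE jm.
have lt_j : (j.+1 < m.+1)%N by rewrite ltn_neqAle jm ltn_ord.
rewrite (bigD1 (inord j.+1)) //= !mxE (negbTE jm) inordK // eqxx mulr1.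
rewrite big1 ?addr0 // => k kj; rewrite mxE (negbTE jm).
suff /negbTE -> : k != j.+1 :> nat by rewrite mulr0.
by apply: contra kj => /eqP <-; rewrite inord_val.
Qed.

(* The splitting lemmas for iterated products need the monoid structure of
   mulmx. *)
HB.instance Definition _ (K : fieldType) (n : nat) :=
  Monoid.isLaw.Build 'M[K]_n 1%:M (@mulmx K n n n)
    (@mulmxA K n n n n) (@mul1mx K n n) (@mulmx1 K n n).

Lemma mu0S (K : fieldType) (n r : nat) (X : set 'M[K]_n) A B :
  mu0 r X A -> X B -> mu0 r.+1 X (A *m B).
Proof.
move=> [M [XM ->]] XB.
exists (fun i => oapp M B (insub (i : nat))); split=> [i|].
  by case: insub.
rewrite big_ord_recr /= insubN ?ltnn //=; congr (_ *m _).
by apply: eq_bigr => i _; rewrite valK.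
Qed.

Lemma mu0_shifted (K : fieldType) (m r : nat) :
  mu0 r (companion_variety K m.+1) `<=` shifted_identity K m.+1 r.
Proof.
elim: r => [|r IH] _ [M [XM ->]].
  by move=> i j _; rewrite big_ord0 mxE addn0.
rewrite big_ord_recr /=.
have [c _ <-] := XM ord_max.
move=> i j; rewrite addnS => jr; rewrite mulmx_companion.
have jm : (j.+1 < m.+1)%N by lia.
rewrite ltn_eqF // IH ?inordK ?addSn //.
by eexists; split; last reflexivity.
Qed.

Lemma shifted_identity_line_closed (K : fieldType) (n r : nat) :
  line_closed (shifted_identity K n r).
Proof.
move=> A B t LA LB i j jr.
by rewrite !mxE LA // LB // subrr mulr0 addr0.
Qed.

(** The step from r + 1 back to r.  For r < n the new first column e_r is forced
by shifted_identity; for r >= n any column would do, and reducing r modulo n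
keeps prepend compatible with the cyclic shifts below. *)
Definition prepend (K : fieldType) (m r : nat) (T : 'M[K]_m.+1) : 'M[K]_m.+1 :=
  \matrix_(i, j) if j == 0 then (i == (r %% m.+1)%N :> nat)%:R
                 else T i (inord j.-1).

Lemma prepend_shifted (K : fieldType) (m r : nat) (T : 'M[K]_m.+1) :
  shifted_identity K m.+1 r.+1 T ->
  shifted_identity K m.+1 r (prepend K m r T).
Proof.
move=> LT i j jr; rewrite mxE; case: eqP => [j0|/eqP j0].
  by rewrite j0 /= add0n modn_small // -[r]add0n; rewrite j0 in jr.
have j0' : (0 < j)%N by rewrite lt0n.
rewrite LT inordK //; first by rewrite -addSnnS prednK.
- by have := ltn_ord j; lia.
- by have := ltn_ord j; lia.
- by have := ltn_ord j; lia.
Qed.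

Lemma prepend_companion (K : fieldType) (m r : nat) (T : 'M[K]_m.+1) :
  prepend K m r T \in unitmx ->
  T = prepend K m r T *m
      companion (invmx (prepend K m r T) *m col ord_max T).
Proof.
move=> uA; apply/matrixP => i j; rewrite mulmx_companion mulKVmx //.
case: eqP => [[jm]|/eqP jm].
  by rewrite mxE; congr (T _ _); apply: val_inj.
have lt_j : (j.+1 < m.+1)%N by rewrite ltn_neqAle jm ltn_ord.
by rewrite mxE -val_eqE /= inordK //= inord_val.
Qed.

(** The r-th power of the cyclic permutation matrix: an explicit point of
shifted_identity that is invertible for every r. *)
Definition cyclic_shift (K : fieldType) (m r : nat) : 'M[K]_m.+1 :=
  \matrix_(i, j) (i == ((j + r) %% m.+1)%N :> nat)%:R.

Lemma cyclic_shift_unit (K : fieldType) (m r : nat) :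
  cyclic_shift K m r \in unitmx.
Proof.
have -> : cyclic_shift K m r = (perm_mx (perm (addIr (inZp r : 'I_m.+1))))^T.
  apply/matrixP => i j; rewrite !mxE permE -val_eqE /= modnDmr eq_sym.
  by [].
by rewrite unitmx_tr unitmx_perm.
Qed.

Lemma prepend_cyclic_shift (K : fieldType) (m r : nat) :
  prepend K m r (cyclic_shift K m r.+1) = cyclic_shift K m r.
Proof.
apply/matrixP => i j; rewrite !mxE; case: eqP => [->|/eqP j0] //.
have j0' : (0 < j)%N by rewrite lt0n.
rewrite inordK -?addSnnS ?prednK //; by have := ltn_ord j; lia.
Qed.

Lemma cyclic_shift_shifted (K : fieldType) (m r : nat) :
  shifted_identity K m.+1 r (cyclic_shift K m r).
Proof. by move=> i j jr; rewrite mxE modn_small. Qed.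

Lemma prepend_line (K : fieldType) (m r : nat) (S T : 'M[K]_m.+1) t :
  prepend K m r (S + t *: (T - S)) =
  prepend K m r S + t *: (prepend K m r T - prepend K m r S).
Proof.
apply/matrixP => i j; rewrite !mxE; case: eqP => // _.
by rewrite subrr mulr0 addr0.
Qed.

(** Density of the products.  When prepending a column to S gives an invertible
matrix, S is a product and the induction hypothesis applies; a general T is
reached along the line from the cyclic shift, on which this case is generic. *)
Lemma shifted_sub_mu (K : numFieldType) (m r : nat) :
  shifted_identity K m.+1 r `<=` mu r (companion_variety K m.+1).
Proof.
elim: r => [|r IH] T LT.
  apply: sub_gen_smallest; exists (fun=> 1%:M); split=> [[]//|].
  rewrite big_ord0; apply/matrixP => i j.
  by rewrite LT ?addn0 // mxE -val_eqE.
have unit_case S : shifted_identity K m.+1 r.+1 S ->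
    prepend K m r S \in unitmx -> mu r.+1 (companion_variety K m.+1) S.
  move=> LS uS; rewrite (prepend_companion _ _ _ _ uS).
  apply: zariski_closure_mulmxr (IH _ (prepend_shifted _ _ _ _ LS)) => A XA.
  by apply: mu0S => //; eexists.
apply/in_zariski_closure => p pX; apply/eqP/negPn/negP => pT.
pose S := cyclic_shift K m r.+1.
have [q1 q1E] := mxeval_line _ _ p S (T - S).
have [q2 q2E] := det_line _ _ (prepend K m r S)
  (prepend K m r T - prepend K m r S).
have [||t] := poly_nonroot2 _ q1 q2 1 0.
- by rewrite q1E lineE1.
- rewrite q2E lineE0 prepend_cyclic_shift -unitfE.
  exact: cyclic_shift_unit.
rewrite q1E q2E -prepend_line => /andP[/eqP pt dt]; apply: pt.
have /in_zariski_closure :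
    mu r.+1 (companion_variety K m.+1) (S + t *: (T - S)).
  apply: unit_case; last by rewrite unitmxE unitfE.
  exact: shifted_identity_line_closed (cyclic_shift_shifted _ _ _) LT.
exact.
Qed.

(** The last min(r, n) columns, in the row-major numbering of mxvec. *)
Definition free_entries (n r : nat) : {set 'I_(n * n)} :=
  [set mxvec_index ij.1 ij.2 |
    ij in [set ij : 'I_n * 'I_n | (n <= ij.2 + r)%N]%SET]%SET.

Lemma mxvec_index_inj (m n : nat) :
  injective (fun ij : 'I_m * 'I_n => mxvec_index ij.1 ij.2).
Proof. by move=> [i j] [i' j'] /cast_ord_inj/enum_rank_inj. Qed.

Lemma card_free_entries (n r : nat) :
  #|free_entries n r| = minn (r * n) (n ^ 2)%N.
Proof.
rewrite card_imset; last exact: mxvec_index_inj.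
have -> : [set ij : 'I_n * 'I_n | (n <= ij.2 + r)%N]%SET =
    (finset.setX [set: 'I_n] [set j : 'I_n | (n <= j + r)%N])%SET.
  by apply/setP => -[i j]; rewrite !inE.
rewrite cardsX cardsT card_ord -mulnn -minnMl mulnC; congr (_ * _)%N.
(* Counted from the right, the free columns are those of index below r. *)
rewrite -sum1_card (reindex_inj rev_ord_inj) /=.
under eq_bigl => j.
  have -> : (rev_ord j \in [set j : 'I_n | (n <= j + r)%N]%SET) = (j < r)%N.
    by rewrite inE /=; have := ltn_ord j; lia.
  over.
have [le_rn|lt_nr] := leqP r n.
  by rewrite -(big_ord_widen n (fun=> 1%N) le_rn) sum1_card card_ord.
rewrite (eq_bigl predT) ?sum1_card ?card_ord // => j.
exact: ltn_trans (ltn_ord j) lt_nr.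
Qed.

Lemma shifted_identity_coord (K : fieldType) (m r : nat) :
  shifted_identity K m.+1 r =
  coord_subspace (free_entries m.+1 r) (cyclic_shift K m r).
Proof.
have freeE (i j : 'I_m.+1) :
    (mxvec_index i j \in free_entries m.+1 r) = (m.+1 <= j + r)%N.
  apply/imsetP/idP => [[[i' j'] /=]|jr].
    by rewrite inE /= => jr /(@mxvec_index_inj _ _ (i, j) (i', j'))[_ ->].
  by exists (i, j); rewrite ?inE.
apply/seteqP; split=> T LT.
  move=> k; case/mxvec_indexP: k => i j; rewrite freeE -ltnNge !mxvecE => jr.
  by rewrite LT // cyclic_shift_shifted.
move=> i j jr; rewrite -(cyclic_shift_shifted K m r i j) //.
rewrite -[LHS]mxvecE -[RHS]mxvecE.
by apply: LT; rewrite freeE -ltnNge.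
Qed.

Lemma mu_companion (K : numFieldType) (m r : nat) :
  mu r (companion_variety K m.+1) = shifted_identity K m.+1 r.
Proof.
apply/seteqP; split; last exact: shifted_sub_mu.
apply: smallest_sub; last exact: mu0_shifted.
by rewrite shifted_identity_coord; apply: coord_subspace_closed.
Qed.

(** * The dimension formula *)

Theorem theorem4p12 (R : realType) (n r : nat) (hn : (1 <= n)%N)
  (hr : (1 <= r)%N) :
  has_krull_dim (mu r (companion_variety R[i] n)) (minn (r * n) (n ^ 2))%N.
Proof.
case: n hn => // m _.
rewrite -card_free_entries mu_companion shifted_identity_coord.
exact: coord_subspace_krull_dim.
Qed.
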